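(* There is a function $\delta_1(C,\sigma^2)$, with $\delta_1(C,\sigma^2)>0$ whenever $\frac{(C-1)\sigma^2}{C}<1$, and a real-valued function $c_1=c_1(\delta,C,\sigma^2)$, such that the following holds. Let $\mathbf{y}=\mathbf{M}\mathbf{x}+\mathbf{e}$ with $\mathbf{M}\in\mathbb{R}^{m\times d}$, $\mathbf{x}\in\mathbb{R}^d$ an $\ell$-cosparse vector with respect to $\mathbf{\Omega}\in\mathbb{R}^{p\times d}$, and $\mathbf{e}\in\mathbb{R}^m$ a bounded additive noise. Let $\sigma_{\mathbf{M}}$ be the largest singular value of $\mathbf{M}$, let $\delta_{2\ell-p}$ be the $\mathbf{\Omega}$-RIP constant of $\mathbf{M}$ for cosparsity $2\ell-p$, and let $\hat{\mathcal{S}}_\ell$ be a cosupport selection procedure implying a near-optimal projection with constant $C_\ell$. Apply either AIHT or AHTP (using $\hat{\mathcal S}_\ell$), either with a certain constant step size $\mu$ (depending on $\delta_1(C_\ell,\sigma_{\mathbf{M}}^2)$) or with the optimal changing step size, obtaining $\hat{\mathbf{x}}^t$ after $t$ iterations. If $$\frac{(C_\ell-1)\sigma_{\mathbf{M}}^2}{C_\ell}<1\qquad\text{and}\qquad \delta_{2\ell-p}<\delta_1(C_\ell,\sigma_{\mathbf{M}}^2),$$ then after a finite number of iterations $t^*$ $$\|\mathbf{x}-\hat{\mathbf{x}}^{t^*}\|_2\le c_1\|\mathbf{e}\|_2,\qquad c_1=c_1(\delta_{2\ell-p},C_\ell,\sigma_{\mathbf{M}}^2),$$ i.e. these algorithms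 lead to a stable recovery.
   Context: Fix $\mathbf{\Omega}\in\mathbb{R}^{p\times d}$ (analysis operator). For $\Lambda\subseteq[p]=\{1,\dots,p\}$, $\mathbf{\Omega}_\Lambda$ is the submatrix of rows indexed by $\Lambda$, and $\mathbf{Q}_\Lambda=\mathbf{I}-\mathbf{\Omega}_\Lambda^\dagger\mathbf{\Omega}_\Lambda$ is the orthogonal projection onto $\{\mathbf{v}:\mathbf{\Omega}_\Lambda\mathbf{v}=0\}$. For an integer $j$, $\mathcal{L}_j=\{\Lambda\subseteq[p]:|\Lambda|\ge j\}$, and $\mathbf{v}\in\mathbb{R}^d$ is $j$-cosparse if $\mathbf{\Omega}\mathbf{v}$ has at least $j$ zero entries. $\mathbf{\Omega}$-RIP constant: $\delta_j$ is the smallest constant such that $(1-\delta_j)\|\mathbf{v}\|_2^2\le\|\mathbf{M}\mathbf{v}\|_2^2\le(1+\delta_j)\|\mathbf{v}\|_2^2$ whenever $\mathbf{\Omega}\mathbf{v}$ has at least $j$ zeros. Near-optimal projection: a map $\hat{\mathcal{S}}_\ell:\mathbb{R}^d\to\mathcal{L}_\ell$ implies a near-optimal projection with constant $C_\ell\ge 1$ if for all $\mathbf{z}\in\mathbb{R}^d$, $\|\mathbf{z}-\mathbf{Q}_{\hat{\mathcal{S}}_\ell(\mathbf{z})}\mathbf{z}\|_2^2\le C_\ell\min_{\Lambda\in\mathcal{L}_\ell}\|\mathbf{z}-\mathbf{Q}_\Lambda\mathbf{z}\|_2^2$. Algorithms AIHT and AHTP: start with $\hat{\mathbf{x}}^0=0$.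 For $t=1,2,\dots$: set $\mathbf{x}_g=\hat{\mathbf{x}}^{t-1}+\mu^t\mathbf{M}^*(\mathbf{y}-\mathbf{M}\hat{\mathbf{x}}^{t-1})$ and $\hat\Lambda^t=\hat{\mathcal{S}}_\ell(\mathbf{x}_g)$; then AIHT sets $\hat{\mathbf{x}}^t=\mathbf{Q}_{\hat\Lambda^t}\mathbf{x}_g$, while AHTP sets $\hat{\mathbf{x}}^t$ to be a minimizer of $\|\mathbf{y}-\mathbf{M}\tilde{\mathbf{x}}\|_2^2$ subject to $\mathbf{\Omega}_{\hat\Lambda^t}\tilde{\mathbf{x}}=0$. Constant step size: $\mu^t=\mu$ for all $t$. Optimal changing step size: at each iteration $\mu^t$ is chosen as a value of $\mu$ minimizing $\|\mathbf{y}-\mathbf{M}\hat{\mathbf{x}}^t\|_2^2$, where $\hat{\mathbf{x}}^t$ is the iterate produced with step size $\mu$.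
   Formalization: For e = 0 the stated bound would demand exact recovery in finitely many iterations, which is false for AIHT; the bound is proved for e ≠ 0, and for e = 0 it is replaced by recovery up to every accuracy ε > 0 after finitely many iterations. *)

(* Defs.v *)
From HB Require Import structures.
From mathcomp Require Import all_boot all_order all_algebra.
From mathcomp Require Import all_classical all_reals.

Set Implicit Arguments.
Unset Strict Implicit.
Unset Printing Implicit Defensive.

Import Order.TTheory GRing.Theory Num.Theory.
Local Open Scope classical_set_scope.
Local Open Scope ring_scope.

(* The library norm on matrices is the sup norm, hence this one. *)
Definition norm2 (R : realType) (n : nat) (v : 'cV[R]_n) : R :=
  Num.sqrt (\sum_(i < n) v i 0 ^+ 2).

Definition singular_values (R : realType) (m n : nat) (A : 'M[R]_(m, n)) :
    set R :=
  [set s | 0 <= s /\ eigenvalue (A^T *m A) (s ^+ 2)].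

(* The set is finite and, for n > 0, nonempty: the supremum is a maximum.
   For n = 0 it is empty and the value is 0. *)
Definition sigma_max (R : realType) (m n : nat) (A : 'M[R]_(m, n)) : R :=
  sup (singular_values A).

(* The four Penrose equations. *)
Definition is_pinv (R : realType) (m n : nat) (A : 'M[R]_(m, n))
    (X : 'M[R]_(n, m)) : Prop :=
  [/\ A *m X *m A = A, X *m A *m X = X,
      (A *m X)^T = A *m X & (X *m A)^T = X *m A].

(* Moore-Penrose inverse. The library's pinvmx is only a one-sided partial
   inverse and does not satisfy the symmetry conditions. *)
Definition pinv (R : realType) (m n : nat) (A : 'M[R]_(m, n)) :
    'M[R]_(n, m) :=
  xget 0 [set X | is_pinv A X].

Lemma gram_unitmx (R : realType) (m n : nat) (A : 'M[R]_(m, n)) :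
  row_free A -> A *m A^T \in unitmx.
Proof.
move=> fA; rewrite -row_free_unit -kermx_eq0; apply/eqP/row_matrixP => i.
rewrite row0; set v := row i _.
have vG : v *m (A *m A^T) = 0 by apply/sub_kermxP; rewrite row_sub.
have : (v *m A) *m (v *m A)^T = 0 by rewrite trmx_mul !mulmxA -(mulmxA v) vG mul0mx.
move=> /(congr1 (fun M : 'M_1 => M 0 0)); rewrite !mxE => /eqP.
rewrite psumr_eq0; last by move=> j _; rewrite [X in _ * X]mxE -expr2 sqr_ge0.
move=> /allP vA0.
apply: (row_free_inj fA); rewrite mul0mx; apply/rowP => j.
have := vA0 j (mem_index_enum j).
by rewrite [X in _ * X]mxE -expr2 sqrf_eq0 [RHS]mxE => /eqP.
Qed.

Lemma is_pinv_uniq (R : realType) (m n : nat) (A : 'M[R]_(m, n))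
    (X Y : 'M[R]_(n, m)) : is_pinv A X -> is_pinv A Y -> X = Y.
Proof.
move=> [AXA XAX AXs XAs] [AYA YAY AYs YAs].
have AXY : A *m X = A *m Y.
  rewrite -AXs -[in LHS]AYA -(mulmxA _ A X) trmx_mul AXs AYs.
  by rewrite mulmxA AXA.
have XAY : X *m A = Y *m A.
  rewrite -XAs -[in LHS]AYA -(mulmxA A) mulmxA trmx_mul YAs XAs.
  by rewrite -(mulmxA Y) (mulmxA A) AXA.
by rewrite -XAX XAY -mulmxA AXY mulmxA YAY.
Qed.

Lemma is_pinv_factor (R : realType) (m n r : nat) (E : 'M[R]_(m, r))
    (B : 'M[R]_(r, n)) :
  row_free E^T -> row_free B ->
  is_pinv (E *m B) (B^T *m invmx (B *m B^T) *m invmx (E^T *m E) *m E^T).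
Proof.
move=> /gram_unitmx; rewrite trmxK => uE /gram_unitmx uB.
set X := (X in is_pinv _ X).
have AX : E *m B *m X = E *m invmx (E^T *m E) *m E^T.
  by rewrite /X -!mulmxA (mulmxA B) mulKVmx.
have XA : X *m (E *m B) = B^T *m invmx (B *m B^T) *m B.
  by rewrite /X -!mulmxA (mulmxA E^T) mulKmx.
split.
- by rewrite AX -!mulmxA (mulmxA E^T) mulKmx.
- by rewrite XA /X -!mulmxA (mulmxA B) mulKVmx.
- by rewrite AX !trmx_mul trmx_inv trmx_mul !trmxK mulmxA.
- by rewrite XA !trmx_mul trmx_inv trmx_mul !trmxK mulmxA.
Qed.

Lemma pinvP (R : realType) (m n : nat) (A : 'M[R]_(m, n)) :
  is_pinv A (pinv A).
Proof.
have fE : row_free (col_base A)^T.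
  by rewrite /row_free mxrank_tr; have := col_base_full A; rewrite /row_full.
have := is_pinv_factor fE (row_base_free A); rewrite mulmx_base.
by rewrite /pinv => AX; case: xgetP => [X _ //|/(_ _ AX)].
Qed.

Definition rows (R : realType) (p d : nat) (Omega : 'M[R]_(p, d))
    (La : {set 'I_p}) : 'M[R]_(#|La|, d) :=
  rowsub (fun k : 'I_#|La| => enum_val k) Omega.

Definition Q (R : realType) (p d : nat) (Omega : 'M[R]_(p, d))
    (La : {set 'I_p}) : 'M[R]_d :=
  1%:M - pinv (rows Omega La) *m rows Omega La.

(* Cosparsity levels are integers, since 2l - p may be negative. *)
Definition cosupports (p : nat) (j : int) : set {set 'I_p} :=
  [set La : {set 'I_p} | j <= #|La|%:Z].
Arguments cosupports : clear implicits.

Definition cosparse (R : realType) (p d : nat) (Omega : 'M[R]_(p, d))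
    (j : int) (v : 'cV[R]_d) : Prop :=
  j <= #|[set i : 'I_p | (Omega *m v) i 0 == 0]%SET|%:Z.

Definition rip_bound (R : realType) (p d m : nat) (Omega : 'M[R]_(p, d))
    (M : 'M[R]_(m, d)) (j : int) (delta : R) : Prop :=
  forall v : 'cV[R]_d, cosparse Omega j v ->
    (1 - delta) * norm2 v ^+ 2 <= norm2 (M *m v) ^+ 2 /\
    norm2 (M *m v) ^+ 2 <= (1 + delta) * norm2 v ^+ 2.

(* As soon as some v != 0 is j-cosparse, the infimum is a minimum and is
   nonnegative. If only v = 0 is j-cosparse every real is a bound, there is no
   smallest one, and the value is 0. *)
Definition rip_const (R : realType) (p d m : nat) (Omega : 'M[R]_(p, d))
    (M : 'M[R]_(m, d)) (j : int) : R :=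
  inf [set delta | rip_bound Omega M j delta].

(* The infimum is over a finite set, hence a minimum; the set is nonempty
   because S z belongs to cosupports p l. *)
Definition near_optimal (R : realType) (p d : nat) (Omega : 'M[R]_(p, d))
    (l : int) (S : 'cV[R]_d -> {set 'I_p}) (C : R) : Prop :=
  [/\ 1 <= C, forall z, cosupports p l (S z) &
      forall z, norm2 (z - Q Omega (S z) *m z) ^+ 2 <=
        C * inf [set norm2 (z - Q Omega La *m z) ^+ 2 | La in cosupports p l]].

Variant algorithm := AIHT | AHTP.

Definition gradient_step (R : realType) (d m : nat) (M : 'M[R]_(m, d))
    (y : 'cV[R]_m) (mu : R) (u : 'cV[R]_d) : 'cV[R]_d :=
  u + mu *: (M^T *m (y - M *m u)).

Definition is_constrained_lsq (R : realType) (p d m : nat)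
    (Omega : 'M[R]_(p, d)) (M : 'M[R]_(m, d)) (y : 'cV[R]_m)
    (La : {set 'I_p}) (w : 'cV[R]_d) : Prop :=
  rows Omega La *m w = 0 /\
  forall w', rows Omega La *m w' = 0 ->
    norm2 (y - M *m w) ^+ 2 <= norm2 (y - M *m w') ^+ 2.

(* w can be the successor of u for the step size mu; a relation, because the
   minimizer in AHTP need not be unique. *)
Definition step (R : realType) (alg : algorithm) (p d m : nat)
    (Omega : 'M[R]_(p, d)) (M : 'M[R]_(m, d)) (y : 'cV[R]_m)
    (S : 'cV[R]_d -> {set 'I_p}) (mu : R) (u w : 'cV[R]_d) : Prop :=
  let xg := gradient_step M y mu u in
  match alg with
  | AIHT => w = Q Omega (S xg) *m xg
  | AHTP => is_constrained_lsq Omega M y (S xg) w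
  end.

Definition constant_step_run (R : realType) (alg : algorithm) (p d m : nat)
    (Omega : 'M[R]_(p, d)) (M : 'M[R]_(m, d)) (y : 'cV[R]_m)
    (S : 'cV[R]_d -> {set 'I_p}) (mu : R) (xhat : nat -> 'cV[R]_d) : Prop :=
  xhat 0%N = 0 /\
  forall t : nat, step alg Omega M y S mu (xhat t) (xhat t.+1).

Definition optimal_step_run (R : realType) (alg : algorithm) (p d m : nat)
    (Omega : 'M[R]_(p, d)) (M : 'M[R]_(m, d)) (y : 'cV[R]_m)
    (S : 'cV[R]_d -> {set 'I_p}) (xhat : nat -> 'cV[R]_d) : Prop :=
  xhat 0%N = 0 /\
  forall t : nat, exists mu : R,
    step alg Omega M y S mu (xhat t) (xhat t.+1) /\
    forall (mu' : R) (w : 'cV[R]_d), step alg Omega M y S mu' (xhat t) w ->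
      norm2 (y - M *m xhat t.+1) ^+ 2 <= norm2 (y - M *m w) ^+ 2.

(* Main.v *)
Require Import Defs.
From HB Require Import structures.
From mathcomp Require Import all_boot all_order all_algebra.
From mathcomp Require Import all_classical all_reals.
From mathcomp Require Import topology normedtype derive sequences.
From mathcomp Require Import zify ring lra.

(* Write [f_t = |y - M xhat_t|^2], [g = 1 - (C - 1) s2 / C], [delta1 = g / 16]
   and [mu = 1 / (1 + delta1)]. Near-optimality of the projection compares the
   new iterate with [x]; expanding both squared distances to the gradient point,
   using the RIP for differences of cosparse vectors and
   [|M^T r|^2 <= s2 |r|^2], gives [f_(t+1) <= (1 - g / 2) f_t + 2 C |e|^2].
   AHTP and the optimal step size can only decrease [f_(t+1)] further. The lower
   RIP bound then turns a small residual into a small error. *)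

Set Implicit Arguments.
Unset Strict Implicit.
Unset Printing Implicit Defensive.

Import Order.TTheory GRing.Theory Num.Theory.
Local Open Scope ring_scope.
Import numFieldNormedType.Exports.

(** * The Euclidean inner product *)

Definition dotv (R : realType) (n : nat) (u v : 'cV[R]_n) : R :=
  (u^T *m v) 0 0.

Section InnerProduct.
Variables (R : realType) (n : nat).
Implicit Types u v w : 'cV[R]_n.

Lemma dotvE u v : dotv u v = \sum_i u i 0 * v i 0.
Proof. by rewrite /dotv mxE; apply: eq_bigr => i _; rewrite mxE. Qed.

Lemma dotvC u v : dotv u v = dotv v u.
Proof. by rewrite !dotvE; apply: eq_bigr => i _; rewrite mulrC. Qed.

Lemma dotvDr u v w : dotv u (v + w) = dotv u v + dotv u w.
Proof. by rewrite /dotv mulmxDr mxE. Qed.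

Lemma dotvZr a u v : dotv u (a *: v) = a * dotv u v.
Proof. by rewrite /dotv -scalemxAr mxE. Qed.

Lemma dotv_ge0 u : 0 <= dotv u u.
Proof. by rewrite dotvE sumr_ge0 // => i _; rewrite -expr2 sqr_ge0. Qed.

Lemma dotv_eq0 u : (dotv u u == 0) = (u == 0).
Proof.
apply/eqP/eqP => [|->]; last by rewrite /dotv mulmx0 mxE.
rewrite dotvE => /eqP; rewrite psumr_eq0 => [|i _]; last by rewrite -expr2 sqr_ge0.
move=> /allP u0; apply/colP => i; have := u0 i (mem_index_enum i).
by rewrite -expr2 sqrf_eq0 mxE => /eqP.
Qed.

Lemma norm2_sqr u : norm2 u ^+ 2 = dotv u u.
Proof.
rewrite dotvE sqr_sqrtr; first by apply: eq_bigr => i _; rewrite expr2.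
by apply: sumr_ge0 => i _; rewrite sqr_ge0.
Qed.

Lemma norm2_ge0 u : 0 <= norm2 u.
Proof. exact: sqrtr_ge0. Qed.

Lemma dotvDD u v : dotv (u + v) (u + v) = dotv u u + 2 * dotv u v + dotv v v.
Proof. by rewrite dotvDr !(dotvC (u + v)) !dotvDr (dotvC v u); ring. Qed.

Lemma dotvZZ a u : dotv (a *: u) (a *: u) = a ^+ 2 * dotv u u.
Proof. by rewrite dotvZr dotvC dotvZr; ring. Qed.

Lemma dotvNr u v : dotv u (- v) = - dotv u v.
Proof. by rewrite -(scaleN1r v) dotvZr mulN1r. Qed.

Lemma dotvBB u v : dotv (u - v) (u - v) = dotv u u - 2 * dotv u v + dotv v v.
Proof. by rewrite dotvDD dotvNr -(scaleN1r v) dotvZZ sqrrN expr1n mul1r mulrN. Qed.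

Lemma dotvBB_le u v : dotv (u - v) (u - v) <= 2 * (dotv u u + dotv v v).
Proof. have := dotv_ge0 (u + v); rewrite dotvDD dotvBB; lra. Qed.

End InnerProduct.

Lemma dotv_mull (R : realType) (m n : nat) (A : 'M[R]_(m, n)) (u : 'cV[R]_n)
    (v : 'cV[R]_m) : dotv (A *m u) v = dotv u (A^T *m v).
Proof. by rewrite /dotv trmx_mul mulmxA. Qed.

(** * Orthogonal projections, cosupports and least squares *)

Section Projection.
Variables (R : realType) (p d : nat) (Omega : 'M[R]_(p, d)).
Implicit Types (La : {set 'I_p}) (v : 'cV[R]_d).

Lemma rows_mul_eq0 La v :
  rows Omega La *m v = 0 <-> forall i, i \in La -> (Omega *m v) i 0 = 0.
Proof.
have E k : (rows Omega La *m v) k 0 = (Omega *m v) (enum_val k) 0.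
  by rewrite !mxE; apply: eq_bigr => j _; rewrite mxE.
split=> [r0 i iLa|r0]; last first.
  by apply/colP => k; rewrite E [RHS]mxE r0 // enum_valP.
by have := E (enum_rank_in iLa i); rewrite enum_rankK_in // r0 mxE.
Qed.

Lemma Q_id La v : rows Omega La *m v = 0 -> Q Omega La *m v = v.
Proof. by move=> r0; rewrite mulmxBl mul1mx -mulmxA r0 mulmx0 subr0. Qed.

Lemma rowsQ La : rows Omega La *m Q Omega La = 0.
Proof.
have [AXA _ _ _] := pinvP (rows Omega La).
by rewrite mulmxBr mulmx1 mulmxA AXA subrr.
Qed.

Lemma Q_tr La : (Q Omega La)^T = Q Omega La.
Proof.
by have [_ _ _ XAs] := pinvP (rows Omega La); rewrite raddfB /= XAs trmx1.
Qed.

Lemma Q_idem La : Q Omega La *m Q Omega La = Q Omega La.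
Proof. by rewrite {1}/Q mulmxBl mul1mx -mulmxA rowsQ mulmx0 subr0. Qed.

(** Pythagoras: [Q] is symmetric and idempotent and fixes [w], so [v - q] is orthogonal to
    [q - w]. *)
Lemma Q_best La v w : rows Omega La *m w = 0 ->
  dotv (v - Q Omega La *m v) (v - Q Omega La *m v) <= dotv (v - w) (v - w).
Proof.
move=> /Q_id Qw; set q := Q Omega La *m v.
have -> : v - w = (v - q) + (q - w) by rewrite subrKA.
have -> : q - w = Q Omega La *m (v - w) by rewrite mulmxBr Qw.
rewrite [leRHS]dotvDD [X in 2 * X]dotvC dotv_mull Q_tr.
rewrite mulmxBr /q mulmxA Q_idem subrr.
by rewrite /dotv mulmx0 [X in 2 * X]mxE mulr0 addr0 lerDl dotv_ge0.
Qed.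

(** Inclusion-exclusion: two subsets of ['I_p] with at least [l] elements each share at least
    [2 * l - p] of them. *)
Lemma cosparse_common La La' (l : int) v :
  cosupports p l La -> cosupports p l La' ->
  (forall i, i \in La -> i \in La' -> (Omega *m v) i 0 = 0) ->
  cosparse Omega (2 * l - p%:Z) v.
Proof.
rewrite /cosupports /= => lLa lLa' v0; rewrite /cosparse.
have sub : (La :&: La' \subset [set i | (Omega *m v) i 0 == 0])%SET.
  by apply/fintype.subsetP => i; rewrite !inE => /andP[iLa iLa']; rewrite v0.
have := subset_leq_card sub; have := cardsUI La La'.
have := max_card (La :|: La')%SET; rewrite card_ord.
move: lLa lLa'.
move: #|La| #|La'| #|(La :|: La')%SET| #|(La :&: La')%SET| => a b c k.
move: #|[set i | _]%SET| => z; lia.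
Qed.

End Projection.

(** The normal equations hold at [pinv A *m y]: its residual is orthogonal to the range of [A]. *)
Lemma lsq_exists (R : realType) (m n : nat) (A : 'M[R]_(m, n)) (y : 'cV[R]_m) :
  exists z : 'cV[R]_n, forall w, dotv (y - A *m z) (y - A *m z) <=
    dotv (y - A *m w) (y - A *m w).
Proof.
have [AXA _ AXs _] := pinvP A; exists (Defs.pinv A *m y) => w.
have ATAX : A^T *m (A *m Defs.pinv A) = A^T by rewrite -AXs -trmx_mul AXA.
set z := Defs.pinv A *m y.
have -> : y - A *m w = (y - A *m z) + A *m (z - w) by rewrite mulmxBr subrKA.
rewrite [leRHS]dotvDD [X in 2 * X]dotvC dotv_mull mulmxBr /z !mulmxA.
rewrite -(mulmxA A^T) ATAX subrr.
by rewrite /dotv mulmx0 [X in 2 * X]mxE mulr0 addr0 lerDl dotv_ge0.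
Qed.

(** * The largest singular value as an operator norm *)

Section SingularValues.
Local Open Scope classical_set_scope.
Variables (R : realType) (m n : nat) (M : 'M[R]_(m, n)).
Implicit Types v : 'cV[R]_n.

Lemma continuous_dotv_mul_tr k (A : 'M[R]_(k, n)) :
  continuous (fun u : 'rV[R]_n => dotv (A *m u^T) (A *m u^T)).
Proof.
have cA i : continuous (fun u : 'rV[R]_n => (A *m u^T) i 0).
  have -> : (fun u : 'rV[R]_n => (A *m u^T) i 0) =
      (fun u => \sum_j A i j * u 0 j).
    by apply/funext => u; rewrite mxE; apply: eq_bigr => j _; rewrite mxE.
  apply: (@continuous_big R) => [|j _ u]; first exact: (@add_continuous R^o).
  by apply: continuousM; [exact: cst_continuous | exact: coord_continuous].
have -> : (fun u : 'rV[R]_n => dotv (A *m u^T) (A *m u^T)) =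
    (fun u => \sum_i (A *m u^T) i 0 * (A *m u^T) i 0).
  by apply/funext => u; rewrite dotvE.
apply: (@continuous_big R) => [|j _ u]; first exact: (@add_continuous R^o).
by apply: continuousM; exact: cA.
Qed.

Lemma dotv_le1_coord v i : dotv v v <= 1 -> `|v i 0| <= 1.
Proof.
rewrite dotvE (bigD1 i) //= => le1.
rewrite -(@ler_pXn2r _ 2) ?nnegrE // expr1n real_normK ?num_real // expr2.
apply: le_trans le1; rewrite lerDl sumr_ge0 // => j _.
by rewrite -expr2 sqr_ge0.
Qed.

(** The unit sphere is compact, so the continuous map [|M v|^2] attains its maximum there; scaling
    extends the bound to every [v]. *)
Lemma rayleigh_max : (exists v, v != 0) ->
  exists2 c, dotv c c = 1 & forall v,
    dotv (M *m v) (M *m v) <= dotv (M *m c) (M *m c) * dotv v v.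
Proof.
move=> [v0 v0N0].
have unit_of v : v != 0 -> exists2 a, a ^+ 2 * dotv v v = 1 & a != 0.
  move=> vN0; have v_gt0 : 0 < dotv v v by rewrite lt_def dotv_eq0 vN0 dotv_ge0.
  exists (Num.sqrt (dotv v v))^-1.
    by rewrite exprVn sqr_sqrtr ?dotv_ge0 // mulVf // gt_eqF.
  by rewrite invr_eq0 gt_eqF // sqrtr_gt0.
pose sphere := [set u : 'rV[R]_n | dotv u^T u^T = 1].
have sphere0 : sphere !=set0.
  have [a a1 _] := unit_of _ v0N0; exists (a *: v0)^T.
  by rewrite /sphere /= trmxK dotvZZ.
(* A closed subset of the compact cube with sides [[-1, 1]]. *)
have sphereC : compact sphere.
  apply: (@subclosed_compact _ _
      [set u : 'rV[R]_n | forall i, `[(-1 : R), 1]%classic (u ord0 i)]).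
  - have -> : sphere =
        (fun u : 'rV[R]_n => dotv (1%:M *m u^T) (1%:M *m u^T)) @^-1` [set x | x = 1].
      by apply/seteqP; split=> u; rewrite /sphere /= mul1mx.
    apply: preimage_closed; last exact: closed_eq.
    by move=> u _; exact: continuous_dotv_mul_tr.
  - apply: (rV_compact (A := fun=> `[(-1 : R), 1]%classic)) => _.
    exact: segment_compact.
  - move=> u u1 i /=; rewrite in_itv /= -ler_norml.
    by have := @dotv_le1_coord u^T i; rewrite mxE; apply; rewrite u1.
have [u + umax] := compact_EVT_max sphere0 sphereC
  (continuous_subspaceT (@continuous_dotv_mul_tr _ M)).
rewrite inE => u1; exists u^T => // v.
have [->|/unit_of[a a1 aN0]] := eqVneq v 0.
  by rewrite /dotv !mulmx0 !mxE mulr0.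
have a2_gt0 : 0 < a ^+ 2 by rewrite lt_def sqr_ge0 expf_neq0.
have := umax (a *: v)^T; rewrite inE /sphere /= trmxK dotvZZ => /(_ a1).
rewrite -scalemxAr dotvZZ => av_le.
by rewrite -(ler_pM2l a2_gt0) mulrCA a1 mulr1.
Qed.

(** The maximum [la] of the Rayleigh quotient bounds every eigenvalue of [M^T *m M] and is itself
    one, with eigenvector the maximizer [c]. Hence [sigma_max M] is the square root of [la]. *)
Lemma sigma_max_bound v :
  dotv (M *m v) (M *m v) <= sigma_max M ^+ 2 * dotv v v.
Proof.
have [->|vN0] := eqVneq v 0; first by rewrite /dotv !mulmx0 !mxE mulr0.
have [c c1 cmax] := rayleigh_max (ex_intro _ v vN0).
set la := dotv (M *m c) (M *m c) in cmax.
have la_ge0 : 0 <= la by exact: dotv_ge0.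
have sub_la s : singular_values M s -> s <= Num.sqrt la.
  move=> [s_ge0 /eigenvalueP[w wM wN0]].
  rewrite -(@ler_pXn2r _ 2) ?nnegrE ?sqrtr_ge0 // sqr_sqrtr //.
  have w_gt0 : 0 < dotv w^T w^T.
    by rewrite lt_def dotv_eq0 dotv_ge0 trmx_eq0 wN0.
  rewrite -(ler_pM2r w_gt0); apply: le_trans (cmax _).
  have -> : dotv (M *m w^T) (M *m w^T) = dotv w^T (w *m (M^T *m M))^T.
    by rewrite dotv_mull !trmx_mul trmxK mulmxA.
  by rewrite wM linearZ dotvZr.
suff la_sv : singular_values M (Num.sqrt la).
  have -> : sigma_max M = Num.sqrt la.
    apply/le_anti/andP; split.
      by apply: ge_sup => //; exists (Num.sqrt la).
    by apply: ub_le_sup => //; exists (Num.sqrt la).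
  by rewrite sqr_sqrtr.
split; first exact: sqrtr_ge0.
rewrite sqr_sqrtr //; apply/eigenvalueP; exists c^T; last first.
  rewrite trmx_eq0; apply/eqP => c0; move: c1; rewrite c0 /dotv mulmx0 mxE.
  by apply/eqP; rewrite eq_sym oner_eq0.
(* [c] minimizes the nonnegative form [v -> la |v|^2 - |M v|^2], so its
   gradient [2 h] at [c] vanishes: test the form at [c - t h]. *)
set h := la *: c - M^T *m (M *m c).
suff /eqP : dotv h h = 0.
  rewrite dotv_eq0 subr_eq0 => /eqP hE.
  by rewrite -[in RHS]linearZ /= hE !trmx_mul trmxK mulmxA.
(* Small enough that [t * la < 1]: the quadratic term [t ^+ 2 * la * G] cannot compensate the linear
   term [2 * t * G] unless [G = 0]. *)
pose t := (la + 1)^-1.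
have la1_gt0 : 0 < la + 1 by rewrite ltr_wpDl.
have t_gt0 : 0 < t by rewrite invr_gt0.
have tla : t * la = 1 - t by rewrite /t; field; rewrite gt_eqF.
have hh : dotv h h = la * dotv c h - dotv (M *m c) (M *m h).
  rewrite {1}/h dotvC dotvDr dotvZr dotvNr (dotvC h c) (dotvC h).
  by rewrite dotv_mull trmxK.
clearbody h; have := cmax (c - t *: h).
rewrite mulmxBr -scalemxAr !dotvBB !dotvZZ !dotvZr.
rewrite -/la c1 => le1.
have : 0 <= dotv (M *m h) (M *m h) by exact: dotv_ge0.
have := dotv_ge0 h.
move: hh le1; set G := dotv h h; set P := dotv c h; set K := dotv (M *m c) _.
set N := dotv (M *m h) _ => hh le1 G0 N0.
have : t * (2 * G) <= t * ((1 - t) * G).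
  rewrite -tla hh; have : 0 <= t ^+ 2 * N by rewrite mulr_ge0 ?sqr_ge0.
  move: le1; rewrite hh; lra.
rewrite ler_pM2l // => le2; apply/le_anti; rewrite G0 andbT.
have : 0 <= t * G by rewrite mulr_ge0 // ltW.
lra.
Qed.
End SingularValues.

(** With [g = M^T r], expand [|M g - s2 r|^2 >= 0], use [<M g, r> = |g|^2] and
    [|M g|^2 <= s2 |g|^2], and divide by [s2]; the case [s2 = 0] is separate. *)
Lemma sigma_max_bound_tr (R : realType) (m n : nat) (M : 'M[R]_(m, n))
    (r : 'cV[R]_m) :
  dotv (M^T *m r) (M^T *m r) <= sigma_max M ^+ 2 * dotv r r.
Proof.
set s2 := sigma_max M ^+ 2; set g := M^T *m r.
have gE : dotv g g = dotv (M *m g) r by rewrite dotv_mull.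
have Mg_le : dotv (M *m g) (M *m g) <= s2 * dotv g g by exact: sigma_max_bound.
have : 0 <= s2 by exact: sqr_ge0.
rewrite le_eqVlt => /predU1P[s20|s2_gt0].
  have Mg0 : M *m g = 0.
    apply/eqP; rewrite -dotv_eq0; apply/eqP/le_anti; rewrite dotv_ge0 andbT.
    by move: Mg_le; rewrite -s20 mul0r.
  by rewrite gE Mg0 dotvC /dotv mulmx0 mxE mulr_ge0 ?dotv_ge0 // -s20.
have := dotv_ge0 (M *m g - s2 *: r).
rewrite dotvBB dotvZr dotvZZ -gE => sq_ge0.
rewrite -(ler_pM2l s2_gt0); lra.
Qed.

(** * Consequences of the RIP, of near-optimality and of one algorithm step *)

Lemma rip_bound_gt (R : realType) (p d m : nat) (Omega : 'M[R]_(p, d))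
    (M : 'M[R]_(m, d)) (j : int) (delta : R) :
  rip_const Omega M j < delta -> rip_bound Omega M j delta.
Proof.
have ne : ([set de | rip_bound Omega M j de] !=set0)%classic.
  (* With this constant the lower RIP bound has a nonpositive left side. *)
  exists (1 + sigma_max M ^+ 2) => v _; rewrite !norm2_sqr.
  have := sigma_max_bound M v; have := dotv_ge0 v; have := dotv_ge0 (M *m v).
  have : 0 <= sigma_max M ^+ 2 * dotv v v by rewrite mulr_ge0 ?sqr_ge0 ?dotv_ge0.
  by move=> *; split; lra.
(* Strictness provides a true bound [de < delta] even if the infimum is not attained; enlarging the
   constant keeps it a bound. *)
move=> /(inf_lt ne)[de de_rip de_lt] v /de_rip[lo up].
have v_ge0 : 0 <= norm2 v ^+ 2 by exact: sqr_ge0.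
split; [apply: le_trans lo | apply: le_trans up _]; rewrite ler_wpM2r //; lra.
Qed.

(** The zero set of [Omega *m x] competes in the infimum, and its projection of [z] is at least as
    close to [z] as [x] is. *)
Lemma near_optimalP (R : realType) (p d : nat) (Omega : 'M[R]_(p, d)) (l : int)
    (S : 'cV[R]_d -> {set 'I_p}) (C : R) (x z : 'cV[R]_d) :
  near_optimal Omega l S C -> cosparse Omega l x ->
  dotv (z - Q Omega (S z) *m z) (z - Q Omega (S z) *m z) <= C * dotv (z - x) (z - x).
Proof.
move=> [C_ge1 _ /(_ z) Sz] x_cosp.
rewrite -norm2_sqr; apply: le_trans Sz _.
rewrite ler_pM2l; last by apply: lt_le_trans C_ge1.
set La := [set i | (Omega *m x) i 0 == 0]%SET.
have x0 : rows Omega La *m x = 0.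
  by apply/rows_mul_eq0 => i; rewrite inE => /eqP.
apply: le_trans (Q_best z x0); apply: ge_inf.
  by exists 0 => _ [La' _ <-]; exact: sqr_ge0.
by exists La; rewrite ?norm2_sqr.
Qed.

(** For AHTP, the constraint is removed by minimizing over the range of [Q]. Optimal step sizes are
    later compared with a successor for the fixed one, which must therefore exist. *)
Lemma step_exists (R : realType) (alg : algorithm) (p d m : nat)
    (Omega : 'M[R]_(p, d)) (M : 'M[R]_(m, d)) (y : 'cV[R]_m)
    (S : 'cV[R]_d -> {set 'I_p}) (mu : R) (u : 'cV[R]_d) :
  exists w, step alg Omega M y S mu u w.
Proof.
case: alg; first by eexists.
rewrite /step; set La := S _.
have [z zmin] := lsq_exists (M *m Q Omega La) y.
exists (Q Omega La *m z); split; first by rewrite mulmxA rowsQ mul0mx.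
by move=> w' /Q_id Qw'; have := zmin w'; rewrite !norm2_sqr -!mulmxA Qw'.
Qed.

(** The AIHT iterate is feasible for the AHTP minimization, so a bound on its residual serves both
    algorithms. *)
Lemma step_residual (R : realType) (alg : algorithm) (p d m : nat)
    (Omega : 'M[R]_(p, d)) (M : 'M[R]_(m, d)) (y : 'cV[R]_m)
    (S : 'cV[R]_d -> {set 'I_p}) (mu : R) (u w : 'cV[R]_d) :
  step alg Omega M y S mu u w ->
  let xg := gradient_step M y mu u in
  rows Omega (S xg) *m w = 0 /\
  dotv (y - M *m w) (y - M *m w) <=
    dotv (y - M *m (Q Omega (S xg) *m xg)) (y - M *m (Q Omega (S xg) *m xg)).
Proof.
case: alg => /= [->|[w0 wmin]]; first by rewrite mulmxA rowsQ mul0mx.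
by split=> //; rewrite -!norm2_sqr; apply: wmin; rewrite mulmxA rowsQ mul0mx.
Qed.

(** * Decrease of the residual in one projected gradient step *)

Section Descent.
Local Open Scope classical_set_scope.
Variables (R : realType) (C s2 : R).
Let g := 1 - (C - 1) * s2 / C.
Let delta := g / 16.
Hypotheses (C_ge1 : 1 <= C) (s2_ge0 : 0 <= s2) (g_gt0 : 0 < g).

Let C_gt0 : 0 < C. Proof. exact: lt_le_trans C_ge1. Qed.

Let g_le1 : g <= 1.
Proof. by rewrite /g gerBl divr_ge0 ?mulr_ge0 ?subr_ge0 ?(ltW C_gt0). Qed.

(* With [h = w - u], [k = x - u] and [r = y - M u], the letters stand for
   [H = |h|^2], [K = |k|^2], [a = <M h, r>], [b = <M k, r>],
   [G = |M^T r|^2], [r2 = |r|^2], [Mh = |M h|^2], [Mk = |M k|^2]. *)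
Lemma descent_scalar (H K a b G r2 Mh Mk : R) :
  let mu := (1 + delta)^-1 in
  0 <= K ->
  H - 2 * (mu * a) + mu ^+ 2 * G <= C * (K - 2 * (mu * b) + mu ^+ 2 * G) ->
  Mh <= (1 + delta) * H -> (1 - delta) * K <= Mk ->
  0 <= G -> G <= s2 * r2 -> 0 <= r2 ->
  0 <= r2 - 2 * b + Mk -> Mk <= 2 * (r2 + (r2 - 2 * b + Mk)) ->
  r2 - 2 * a + Mh <= (1 - g / 2) * r2 + 2 * C * (r2 - 2 * b + Mk).
Proof.
move=> mu K_ge0 proj_le Mh_le Mk_ge G_ge0 G_le r2_ge0 e2_ge0 Mk_le.
set e2 := r2 - 2 * b + Mk in e2_ge0 Mk_le *.
have g1 := g_le1.
have delta_gt0 : 0 < delta by rewrite divr_gt0.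
have q_gt0 : 0 < 1 + delta by rewrite ltr_wpDl // ltW.
have mu_ge0 : 0 <= mu by rewrite invr_ge0 ltW.
have qmu z : (1 + delta) * (mu * z) = z by rewrite mulrA divff ?mul1r // gt_eqF.
(* Multiplying by [1 + delta], the inverse of [mu], turns the distance terms into those of the upper
   RIP bound. *)
have proj_le1 : (1 + delta) * H - 2 * a + mu * G <=
    C * ((1 + delta) * K - 2 * b + mu * G).
  have -> : (1 + delta) * H - 2 * a + mu * G =
      (1 + delta) * (H - 2 * (mu * a) + mu ^+ 2 * G).
    by rewrite -{1}(qmu a) -{1}(qmu (mu * G)); ring.
  have -> : C * ((1 + delta) * K - 2 * b + mu * G) =
      (1 + delta) * (C * (K - 2 * (mu * b) + mu ^+ 2 * G)).
    by rewrite -{1}(qmu b) -{1}(qmu (mu * G)); ring.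
  by rewrite ler_pM2l.
have mu_le1 : mu <= 1 by rewrite invf_le1 //; lra.
(* The definition of [g], rearranged: the gradient terms cost at most [C * (1 - g) * r2], which
   leaves a margin [C * g * r2]. *)
have gC : (C - 1) * s2 = C * (1 - g) by rewrite /g; field; rewrite gt_eqF.
have grad_le : (C - 1) * (mu * G) <= C * (1 - g) * r2.
  rewrite -gC -mulrA ler_wpM2l ?subr_ge0 //.
  by apply: le_trans G_le; rewrite ler_piMl.
(* The choice [delta = g / 16] with [g <= 1] ensures [(1 + delta) / (1 - delta) <= 1 + g / 4]. *)
have K_le : C * ((1 + delta) * K) <= C * ((1 + g / 4) * Mk).
  rewrite ler_pM2l //.
  have K16 : 15 * K <= 16 * Mk.
    have : delta * K <= 16^-1 * K by rewrite ler_wpM2r // /delta; lra.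
    lra.
  have : g * (15 * K) <= g * (16 * Mk) by rewrite ler_pM2l.
  have : 0 <= g * K by rewrite mulr_ge0 // ltW.
  move: Mk_ge; rewrite /delta; lra.
(* The excess [C * (g / 4) * Mk] uses up half of the margin [C * g * r2]; the other half is the
   contraction [g / 2], as [C >= 1]. *)
have Mk_le1 : C * (g * Mk) <= C * (g * (2 * (r2 + e2))) by rewrite !ler_pM2l.
have e_le : C * (g * e2) <= C * (1 * e2) by rewrite ler_pM2l // ler_wpM2r.
have r_le : 1 * (g * r2) <= C * (g * r2).
  by rewrite ler_wpM2r // mulr_ge0 // ltW.
have Ce_ge0 : 0 <= C * e2 by rewrite mulr_ge0 // ltW.
have e2E : C * e2 = C * (r2 - 2 * b + Mk) by [].
lra.
Qed.

Variables (p d m : nat) (Omega : 'M[R]_(p, d)) (M : 'M[R]_(m, d)).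
Variables (x : 'cV[R]_d) (e y : 'cV[R]_m) (l : int) (S : 'cV[R]_d -> {set 'I_p}).
Hypotheses (yE : y = M *m x + e) (x_cosp : cosparse Omega l x).
Hypotheses (S_opt : near_optimal Omega l S C) (s2E : s2 = sigma_max M ^+ 2).
Hypothesis rip : rip_bound Omega M (2 * l - p%:Z) delta.

Let res (u : 'cV[R]_d) := dotv (y - M *m u) (y - M *m u).
(** Shared by [x] and all iterates; it makes their differences cosparse enough for the RIP. *)
Let admissible (u : 'cV[R]_d) :=
  exists2 La, cosupports p l La & rows Omega La *m u = 0.

Let x_adm : admissible x.
Proof.
exists [set i | (Omega *m x) i 0 == 0]%SET; first exact: x_cosp.
by apply/rows_mul_eq0 => i; rewrite inE => /eqP.
Qed.

Let sub_cosparse u w : admissible u -> admissible w ->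
  cosparse Omega (2 * l - p%:Z) (u - w).
Proof.
move=> [La lLa /rows_mul_eq0 u0] [La' lLa' /rows_mul_eq0 w0].
apply: (cosparse_common lLa lLa') => i iLa iLa'.
by rewrite mulmxBr mxE u0 // mxE w0 // subrr.
Qed.

Let res_sub u : M *m (x - u) = (y - M *m u) - e.
Proof. by rewrite yE mulmxBr; rewrite addrAC addrK. Qed.

Lemma projected_step_descent u (xg := gradient_step M y (1 + delta)^-1 u) :
  admissible u ->
  res (Q Omega (S xg) *m xg) <= (1 - g / 2) * res u + 2 * C * dotv e e.
Proof.
move=> u_adm; set mu := (1 + delta)^-1 in xg *.
set w := Q Omega (S xg) *m xg; set r := y - M *m u.
have [_ Scosp _] := S_opt.
have w_adm : admissible w.
  by exists (S xg); [exact: Scosp | rewrite mulmxA rowsQ mul0mx].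
have := near_optimalP xg S_opt x_cosp; rewrite -/w.
have xgB v : xg - v = mu *: (M^T *m r) - (v - u).
  by rewrite /xg /gradient_step -/r opprB [RHS]addrC addrAC.
have sqB v : dotv (xg - v) (xg - v) =
    dotv (v - u) (v - u) - 2 * (mu * dotv (M *m (v - u)) r) +
    mu ^+ 2 * dotv (M^T *m r) (M^T *m r).
  by rewrite xgB dotvBB dotvZZ (dotvC (mu *: _)) dotvZr (dotv_mull M); ring.
rewrite !sqB => proj_le.
have [_] := rip (sub_cosparse w_adm u_adm); rewrite !norm2_sqr => Mh_le.
have [Mk_ge _] := rip (sub_cosparse x_adm u_adm); rewrite !norm2_sqr in Mk_ge.
(* The noise is the residual left at [x], so [|e|^2] expands in the same quantities as the residual
   at [w]. *)
have eE : e = r - M *m (x - u) by rewrite res_sub -/r subKr.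
have e2E : dotv e e = dotv r r - 2 * dotv (M *m (x - u)) r +
    dotv (M *m (x - u)) (M *m (x - u)) by rewrite {1 2}eE dotvBB (dotvC r).
have -> : res w = dotv r r - 2 * dotv (M *m (w - u)) r +
    dotv (M *m (w - u)) (M *m (w - u)).
  rewrite -(dotvC r) -dotvBB /res.
  by have -> : r - M *m (w - u) = y - M *m w by rewrite mulmxBr opprB subrKA.
rewrite e2E; apply: descent_scalar _ proj_le Mh_le Mk_ge _ _ _ _ _.
- exact: dotv_ge0.
- exact: dotv_ge0.
- by rewrite s2E; exact: sigma_max_bound_tr.
- exact: dotv_ge0.
- by rewrite -e2E dotv_ge0.
- by rewrite -e2E res_sub; exact: dotvBB_le.
Qed.

(** As [delta <= 1 / 16], the lower RIP bound gives [15 / 16 * |x - u|^2 <= |M (x - u)|^2], and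
    [M (x - u)] is the residual minus [e]. *)
Lemma error_le_residual u : admissible u ->
  dotv (x - u) (x - u) <= 4 * (res u + dotv e e).
Proof.
move=> u_adm; have [+ _] := rip (sub_cosparse x_adm u_adm).
rewrite !norm2_sqr res_sub => lo.
have := dotvBB_le (y - M *m u) e; rewrite -/(res u) => up.
have := dotv_ge0 (x - u); set D := dotv (x - u) _ in lo *.
have : delta * D <= 16^-1 * D.
  by rewrite ler_wpM2r ?dotv_ge0 // /delta; move: g_le1; lra.
move: lo up; set f := res u; set e2 := dotv e e; set F := dotv _ _.
lra.
Qed.

(** * Whole runs: geometric decay of the residual down to the noise level *)

Variables (alg : algorithm) (xhat : nat -> 'cV[R]_d).
Hypothesis xhat_run :
  constant_step_run alg Omega M y S (1 + delta)^-1 xhat \/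
  optimal_step_run alg Omega M y S xhat.

Let xhat_adm t : admissible (xhat t).
Proof.
have [_ Scosp _] := S_opt; case: t => [|t].
  (* The initial iterate 0 satisfies every constraint; the cosupport of [x] shows that one of the
     required size exists. *)
  have [La lLa _] := x_adm; exists La => //.
  by case: xhat_run => -[-> _]; rewrite mulmx0.
have [mu st] : exists mu, step alg Omega M y S mu (xhat t) (xhat t.+1).
  case: xhat_run => [[_ /(_ t) st]|[_ /(_ t)[mu [st _]]]]; last by exists mu.
  by exists (1 + delta)^-1.
have [w0 _] := step_residual st.
by exists (S (gradient_step M y mu (xhat t))); first exact: Scosp.
Qed.

Lemma run_descent t :
  res (xhat t.+1) <= (1 - g / 2) * res (xhat t) + 2 * C * dotv e e.
Proof.
apply: le_trans (projected_step_descent (xhat_adm t)).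
case: xhat_run => [[_ /(_ t) st]|[_ /(_ t)[mu [_ opt]]]].
  by have [_] := step_residual st.
have [w st] := step_exists alg Omega M y S (1 + delta)^-1 (xhat t).
have [_] := step_residual st; apply: le_trans.
by have := opt _ _ st; rewrite !norm2_sqr.
Qed.

(** [4 * C / g * |e|^2] is the fixed point of the recursion in [run_descent]. *)
Lemma run_residual t :
  res (xhat t) <= (1 - g / 2) ^+ t * res (xhat 0%N) + 4 * C / g * dotv e e.
Proof.
elim: t => [|t IHt].
  by rewrite expr0 mul1r lerDl mulr_ge0 ?dotv_ge0 // divr_ge0 ?mulr_ge0 // ltW.
apply: le_trans (run_descent t) _.
have rho_ge0 : 0 <= 1 - g / 2 by move: g_le1; lra.
have := ler_wpM2l rho_ge0 IHt; rewrite mulrDr mulrA -exprS => le.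
have -> : 4 * C / g * dotv e e =
    (1 - g / 2) * (4 * C / g * dotv e e) + 2 * C * dotv e e.
  by field; rewrite gt_eqF.
by rewrite addrA lerD2r.
Qed.

Lemma run_error eps : 0 < eps ->
  exists t, dotv (x - xhat t) (x - xhat t) <=
    4 * ((4 * C / g + 1) * dotv e e + eps).
Proof.
move=> eps_gt0; set f0 := res (xhat 0%N).
have rho_lt1 : `|1 - g / 2| < 1.
  by rewrite ltr_norml; move: g_le1 g_gt0 => *; apply/andP; split; lra.
have /cvgr0_norm_lt/(_ eps eps_gt0)[t _ /(_ t (leqnn t)) /= small] :
  geometric f0 (1 - g / 2) n @[n --> \oo] --> (0 : R) by exact: cvg_geometric.
exists t; apply: le_trans (error_le_residual (xhat_adm t)) _.
have := run_residual t; rewrite -/f0.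
move: (ler_norm _ : _ <= `|f0 * (1 - g / 2) ^+ t|).
rewrite mulrC; set q := _ ^+ t * f0; move: small; rewrite mulrC -/q.
lra.
Qed.

End Descent.

(* For e = 0 the iterates converge to x without in general reaching it, so the
   noiseless case is stated as recovery up to any prescribed accuracy. *)
Theorem theorem6p2 (R : realType) :
  exists (delta1 : R -> R -> R) (c1 : R -> R -> R -> R) (mu : R -> R),
    (forall C s2 : R, (C - 1) * s2 / C < 1 -> 0 < delta1 C s2) /\
    forall (p d m : nat) (Omega : 'M[R]_(p, d)) (M : 'M[R]_(m, d))
      (x : 'cV[R]_d) (e y : 'cV[R]_m) (l : int)
      (S : 'cV[R]_d -> {set 'I_p}) (C : R)
      (alg : algorithm) (xhat : nat -> 'cV[R]_d),
      y = M *m x + e ->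
      cosparse Omega l x ->
      near_optimal Omega l S C ->
      let s2 := sigma_max M ^+ 2 in
      let delta := rip_const Omega M (2 * l - p%:Z) in
      constant_step_run alg Omega M y S (mu (delta1 C s2)) xhat \/
        optimal_step_run alg Omega M y S xhat ->
      (C - 1) * s2 / C < 1 ->
      delta < delta1 C s2 ->
      (e != 0 ->
        exists t : nat, norm2 (x - xhat t) <= c1 delta C s2 * norm2 e) /\
      (e = 0 ->
        forall eps : R, 0 < eps -> exists t : nat, norm2 (x - xhat t) <= eps).
Proof.
pose g C s2 : R := 1 - (C - 1) * s2 / C.
exists (fun C s2 => g C s2 / 16).
(* The square root of the factor in [run_error] for [eps = |e|^2], which adds one more to
   [4 * C / g + 1]. *)
exists (fun _ C s2 => Num.sqrt (4 * (4 * C / g C s2 + 2))).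
exists (fun de => (1 + de)^-1).
split=> [C s2 lt1|]; first by rewrite divr_gt0 // subr_gt0.
move=> p d m Omega M x e y l S C alg xhat yE x_cosp S_opt s2 delta run lt1.
move=> /rip_bound_gt rip.
have [C_ge1 _ _] := S_opt.
have g_gt0 : 0 < g C s2 by rewrite subr_gt0.
have err := run_error C_ge1 (sqr_ge0 _) g_gt0 yE x_cosp S_opt erefl rip run.
split=> [eN0|e0 eps eps_gt0].
  have e2_gt0 : 0 < dotv e e by rewrite lt_def dotv_eq0 eN0 dotv_ge0.
  have [t le_t] := err _ e2_gt0; exists t.
  have c_ge0 : 0 <= 4 * (4 * C / g C s2 + 2).
    by rewrite mulr_ge0 ?addr_ge0 // divr_ge0 ?mulr_ge0 ?(ltW g_gt0) //
      (le_trans _ C_ge1).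
  rewrite -(@ler_pXn2r _ 2) ?nnegrE ?mulr_ge0 ?norm2_ge0 ?sqrtr_ge0 //.
  rewrite exprMn !norm2_sqr sqr_sqrtr //; apply: le_trans le_t _.
  by rewrite -/(g C s2); lra.
(* The division by 4 cancels the factor 4 in [run_error]. *)
have eps4_gt0 : 0 < eps ^+ 2 / 4 by rewrite divr_gt0 // exprn_gt0.
have [t le_t] := err _ eps4_gt0.
exists t; rewrite -(@ler_pXn2r _ 2) ?nnegrE ?norm2_ge0 ?(ltW eps_gt0) //.
rewrite norm2_sqr; apply: le_trans le_t _.
by rewrite e0 /dotv mulmx0 mxE mulr0 add0r mulrCA divff ?pnatr_eq0 ?mulr1.
Qed.
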